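(* Let $0<v_i^l\le v_i^u$, $0<v_j^l\le v_j^u$ and $0\le\theta_{ij}^l<\theta_{ij}^u\le\pi/2$ be real constants, and put $\phi_{ij}=(\theta_{ij}^u+\theta_{ij}^l)/2$, $\delta_{ij}=(\theta_{ij}^u-\theta_{ij}^l)/2$, $v_i^\sigma=v_i^l+v_i^u$, $v_j^\sigma=v_j^l+v_j^u$. Then the lifted nonlinear cut $$v_i^\sigma v_j^\sigma\bigl(w^R_{ij}\cos\phi_{ij}+w^I_{ij}\sin\phi_{ij}\bigr)-v_j^l\cos(\delta_{ij})v_j^\sigma w_i-v_i^l\cos(\delta_{ij})v_i^\sigma w_j\ \ge\ -v_i^lv_j^l\cos(\delta_{ij})\,(v_i^lv_j^l-v_i^uv_j^u)$$ dominates the cut $$w^R_{ij}\cos\phi_{ij}+w^I_{ij}\sin\phi_{ij}\ \ge\ v_i^lv_j^l\cos\delta_{ij}:$$ every $(w^R_{ij},w^I_{ij},w_i,w_j)\in\mathbb{R}^4$ with $(v_i^l)^2\le w_i\le(v_i^u)^2$ and $(v_j^l)^2\le w_j\le(v_j^u)^2$ that satisfies the first inequality also satisfies the second.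
   Context: One inequality dominates another if, within the variable bounds on $w_i$ and $w_j$ (squared voltage magnitudes at the two ends of a line), every point satisfying the first also satisfies the second. *)

(* Defs.v *)
From Stdlib Require Import Reals.
Open Scope R_scope.

(* A point (wR_ij, wI_ij, w_i, w_j) of R^4. *)
Record point : Type := Point { wR : R; wI : R; wi : R; wj : R }.

Definition inequality : Type := point -> Prop.

(* [vil], [viu], [vjl], [vju] bound voltage magnitudes, whereas [wi] and [wj]
   are squared magnitudes. *)
Definition in_bounds (vil viu vjl vju : R) (p : point) : Prop :=
  vil ^ 2 <= wi p <= viu ^ 2 /\ vjl ^ 2 <= wj p <= vju ^ 2.

Definition dominates (vil viu vjl vju : R) (P Q : inequality) : Prop :=
  forall p : point, in_bounds vil viu vjl vju p -> P p -> Q p.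

Definition lifted_nonlinear_cut (vil viu vjl vju phi delta : R) : inequality :=
  fun p =>
    let vis := vil + viu in
    let vjs := vjl + vju in
    vis * vjs * (wR p * cos phi + wI p * sin phi)
      - vjl * cos delta * vjs * wi p
      - vil * cos delta * vis * wj p
    >= - vil * vjl * cos delta * (vil * vjl - viu * vju).

Definition lower_bound_cut (vil vjl phi delta : R) : inequality :=
  fun p => wR p * cos phi + wI p * sin phi >= vil * vjl * cos delta.

(* Main.v *)
Require Import Defs.
From Stdlib Require Import Reals Lra.
Open Scope R_scope.

(** With [cos delta >= 0], the lifted nonlinear cut is weakest at the corner
    [w_i = vil^2], [w_j = vjl^2]; there it is exactly the lower-bound cut
    multiplied by the positive factor [(vil + viu) * (vjl + vju)]. *)

Theorem proposition4p7 (vil viu vjl vju thetal thetau : R)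
  (hvi0 : 0 < vil) (hvi : vil <= viu)
  (hvj0 : 0 < vjl) (hvj : vjl <= vju)
  (htheta0 : 0 <= thetal) (htheta : thetal < thetau) (hthetau : thetau <= PI / 2) :
  let phi := (thetau + thetal) / 2 in
  let delta := (thetau - thetal) / 2 in
  dominates vil viu vjl vju
    (lifted_nonlinear_cut vil viu vjl vju phi delta)
    (lower_bound_cut vil vjl phi delta).
Proof.
  intros phi delta p [[hwi _] [hwj _]].
  unfold lifted_nonlinear_cut, lower_bound_cut; cbv zeta; intros hcut.
  (* The angle bounds give [0 < delta <= PI / 4]. *)
  assert (hcos : 0 <= cos delta) by (apply cos_ge_0; unfold delta; lra).
  set (c := cos delta) in *.
  set (x := wR p * cos phi + wI p * sin phi) in *.
  assert (hs : 0 < (vil + viu) * (vjl + vju)) by (apply Rmult_lt_0_compat; lra).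
  (* [hi] and [hj] measure how far the [wi] and [wj] terms of the cut exceed their corner values. *)
  assert (hi : 0 <= vjl * c * (vjl + vju) * (wi p - vil ^ 2))
    by (repeat apply Rmult_le_pos; lra).
  assert (hj : 0 <= vil * c * (vil + viu) * (wj p - vjl ^ 2))
    by (repeat apply Rmult_le_pos; lra).
  (* Linear in the monomials: the sum of [hcut], [hi] and [hj] is the goal, since [vil * (vjl + vju)
     + vjl * (vil + viu) - (vil * vjl - viu * vju)] equals [(vil + viu) * (vjl + vju)]. *)
  apply Rle_ge, (Rmult_le_reg_l _ _ _ hs); lra.
Qed.
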